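(* For $|q|<1$, \[ \sum_{i,j\geq 0}\frac{q^{\frac{i(3i-1)}{2}+4ij+4j^2}}{(q;q)_i (q^2;q^2)_j} =\frac{1}{(q,q^4;q^5)_\infty},\qquad \sum_{i,j\geq 0}\frac{q^{\frac{i(3i+1)}{2}+4ij+4j^2+2j}}{(q;q)_i(q^2;q^2)_j}=\frac{1}{(q^2,q^3;q^5)_\infty}. \]
   Context: For $|q|<1$: $(a;q)_0=1$, $(a;q)_n=\prod_{k=0}^{n-1}(1-aq^k)$, $(a;q)_\infty=\prod_{k\ge0}(1-aq^k)$, $(a_1,\dots,a_m;q)_n=\prod_\ell(a_\ell;q)_n$. *)

(* Defs.v *)
From Stdlib Require Import Reals.
From Coquelicot Require Import Coquelicot.
Open Scope C_scope.

Fixpoint qpoch (a q : C) (n : nat) : C :=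
  match n with
  | O => 1
  | S m => qpoch a q m * (1 - a * Cpow q m)
  end.

Definition qpoch_inf_is (a q P : C) : Prop :=
  filterlim (fun n => qpoch a q n) eventually (locally P).

Fixpoint csum (n : nat) (g : nat -> C) : C :=
  match n with
  | O => 0
  | S m => csum m g + g m
  end.

Definition dsum_is (f : nat -> nat -> C) (S : C) : Prop :=
  filterlim (fun N => csum N (fun i => csum N (fun j => f i j)))
    eventually (locally S).

(* Main.v *)
Require Import Defs.
From Stdlib Require Import Reals Lra Lia Arith.
From Coquelicot Require Import Coquelicot.
Open Scope C_scope.

(** With [n = i + 2j] the exponents are [n^2 + e n + i(i-1)/2], where [e = 0] for the first
    identity and [e = 1] for the second.  Since [(-z;q)_oo / (z^2;q^2)_oo = 1 / (z;q)_oo], the sum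
    over [i + 2j = n] of [q^(i(i-1)/2) / ((q;q)_i (q^2;q^2)_j)] is [1 / (q;q)_n], so both double
    sums are Rogers-Ramanujan sums [sum_n q^(n^2 + e n) / (q;q)_n].

    These are evaluated with a Bailey chain.  A finite Jacobi triple product in [x], [y],
    [Q = xy], with the bilateral sum folded onto [j >= 0], gives for [x = 1] the unit Bailey pair;
    two Bailey steps (a q-Vandermonde sum each) turn it into a finite Rogers-Ramanujan identity
    whose theta coefficients are those of the triple product for [Q = q^5] and
    [(x, y) = (q^2, q^3)] or [(q^4, q)].  All limits are taken at the geometric rate [r^N],
    [r = sqrt |q|], which makes every interchange of limit and sum a single estimate. *)

(** * Finite sums and their rearrangement *)

Lemma csum_ext (n : nat) (f g : nat -> C) :
  (forall k, (k < n)%nat -> f k = g k) -> csum n f = csum n g.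
Proof.
  induction n as [|n IH]; intros H; simpl; [reflexivity|].
  rewrite IH, H; auto with arith.
Qed.

Lemma csum_plus (n : nat) (f g : nat -> C) :
  csum n (fun k => f k + g k) = csum n f + csum n g.
Proof. induction n as [|n IH]; simpl; [|rewrite IH]; ring. Qed.

Lemma csum_scal (n : nat) (c : C) (f : nat -> C) :
  csum n (fun k => c * f k) = c * csum n f.
Proof. induction n as [|n IH]; simpl; [|rewrite IH]; ring. Qed.

Lemma csum_lin (n : nat) (a b : C) (f g : nat -> C) :
  csum n (fun j => a * f j + - b * g j) = a * csum n f - b * csum n g.
Proof. rewrite csum_plus, !csum_scal; ring. Qed.

Lemma csum_shift (n : nat) (f : nat -> C) :
  csum (S n) f = f O + csum n (fun k => f (S k)).
Proof.
  induction n as [|n IH]; [simpl; ring|].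
  change (csum (S (S n)) f) with (csum (S n) f + f (S n)).
  rewrite IH; simpl; ring.
Qed.

Lemma csum_zero (n : nat) (f : nat -> C) :
  (forall k, (k < n)%nat -> f k = 0) -> csum n f = 0.
Proof.
  induction n as [|n IH]; intros H; simpl; [reflexivity|].
  rewrite IH, H; auto with arith; ring.
Qed.

(** The change of order behind the Bailey step: pairs with sum below [N], taken along diagonals or
    along rows. *)
Lemma csum_triangle (N : nat) (f : nat -> nat -> C) :
  csum N (fun s => csum (S s) (fun r => f r (s - r)%nat))
  = csum N (fun r => csum (N - r) (f r)).
Proof.
  induction N as [|N IH]; [reflexivity|].
  change (csum N (fun s => csum (S s) (fun r => f r (s - r)%nat))
          + (csum N (fun r => f r (N - r)%nat) + f N (N - N)%nat)
          = csum N (fun r => csum (S N - r) (f r)) + csum (S N - N) (f N)).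
  rewrite IH.
  replace (S N - N)%nat with 1%nat by lia.
  rewrite Nat.sub_diag.
  rewrite (csum_ext N (fun r => csum (S N - r) (f r))
             (fun r => csum (N - r) (f r) + f r (N - r)%nat)).
  - rewrite csum_plus; simpl; ring.
  - intros k Hk; replace (S N - k)%nat with (S (N - k)) by lia; reflexivity.
Qed.

(** * Reciprocal q-factorials, the q-Vandermonde sum and the Bailey step *)

Definition iq (q : C) (n : nat) : C := / qpoch q q n.

(** The algebraic condition under which the finite identities are proved; it is applied to the bases
    [q], [q ^ 2] and [q ^ 5]. *)
Definition regular (q : C) : Prop := forall n, 1 - q * Cpow q n <> 0.

Lemma regular_of_Cmod (q : C) : (Cmod q < 1)%R -> regular q.
Proof.
  intros hq n H.
  assert (E : q * q ^ n = 1).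
  { replace (q * q ^ n) with (1 - (1 - q * q ^ n)) by ring; rewrite H; ring. }
  assert (E' : (Cmod q ^ S n = 1)%R).
  { rewrite <- Cmod_pow; simpl; rewrite E; apply Cmod_1. }
  pose proof (Cmod_ge_0 q).
  assert (hn : (Cmod q ^ n <= 1)%R) by (rewrite <- (pow1 n); apply pow_incr; lra).
  simpl in E'; nra.
Qed.

Lemma qpoch_neq_0 (q : C) (n : nat) : regular q -> qpoch q q n <> 0.
Proof.
  intros hq; induction n as [|n IH]; simpl.
  - apply C1_nz.
  - apply Cmult_neq_0; auto.
Qed.

Lemma iq_0 (q : C) : iq q 0 = 1.
Proof. unfold iq; simpl; field. Qed.

Lemma iq_S (q : C) (n : nat) : regular q -> iq q n = (1 - q * q ^ n) * iq q (S n).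
Proof.
  intros hq; unfold iq; simpl; field; split; auto using qpoch_neq_0.
Qed.

Lemma regular_cancel (q : C) (n : nat) (a b : C) :
  regular q -> (1 - q * q ^ n) * a = (1 - q * q ^ n) * b -> a = b.
Proof.
  intros hq H.
  replace a with (/ (1 - q * q ^ n) * ((1 - q * q ^ n) * a)) by (field; auto).
  rewrite H; field; auto.
Qed.

Lemma Cpow_sub_split (q : C) (n j : nat) : (j <= n)%nat -> q ^ n = q ^ j * q ^ (n - j).
Proof. intros H; rewrite <- Cpow_add_r; f_equal; lia. Qed.

(** Induction on [M] for all [c] at once: if [V(M, c)] denotes the sum, then [(1 - q^(M+1)) V(M+1,
    c) = V(M, c) + q^(M+1+c) V(M, c+1)]. *)
Lemma q_vandermonde (q : C) (hq : regular q) (M c : nat) :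
  csum (S M) (fun t => q ^ (t * t + c * t) * iq q (M - t) * iq q t * iq q (t + c))
  = iq q M * iq q (M + c).
Proof.
  revert c; induction M as [|M IH]; intros c.
  - simpl; rewrite iq_0, Nat.mul_0_r; simpl; ring.
  - apply (regular_cancel q M); [assumption|].
    rewrite <- csum_scal.
    (* This is [1 - q^(M+1) = (1 - q^(M+1-t)) + q^(M+1-t) (1 - q^t)]: the first factor is absorbed
       by [iq q (S M - t)], the second by [iq q t]. *)
    rewrite (csum_ext _ _ (fun t =>
      (1 - q ^ (S M - t)) * (q ^ (t * t + c * t) * iq q (S M - t) * iq q t * iq q (t + c))
      + q ^ (S M - t) * (1 - q ^ t)
        * (q ^ (t * t + c * t) * iq q (S M - t) * iq q t * iq q (t + c)))).
    2: { intros t Ht; change (q * q ^ M) with (q ^ S M).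
         rewrite (Cpow_sub_split q (S M) t) by lia; ring. }
    rewrite csum_plus.
    (* The term [t = S M] of the first sum and the term [t = 0] of the second carry a factor
       [1 - q ^ 0] and drop out. *)
    change (csum (S (S M)) ?f) with (csum (S M) f + f (S M)) at 1; cbv beta.
    rewrite (csum_shift (S M)); cbv beta.
    rewrite (csum_ext (S M) _
      (fun t => q ^ (t * t + c * t) * iq q (M - t) * iq q t * iq q (t + c))).
    2: { intros t Ht; replace (S M - t)%nat with (S (M - t)) by lia.
         rewrite (iq_S q (M - t)) by assumption; simpl; ring. }
    rewrite (csum_ext (S M) (fun k => _ * (1 - q ^ S k) * _)
      (fun t => q ^ (S M + c) *
        (q ^ (t * t + S c * t) * iq q (M - t) * iq q t * iq q (t + S c)))).
    2: { intros t Ht.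
         replace (S M - S t)%nat with (M - t)%nat by lia.
         replace (S t * S t + c * S t)%nat with ((t * t + S c * t) + S t + c)%nat by lia.
         replace (S t + c)%nat with (t + S c)%nat by lia.
         rewrite (iq_S q t) by assumption.
         replace (S M + c)%nat with ((M - t) + S t + c)%nat by lia.
         rewrite !Cpow_add_r; simpl; ring. }
    rewrite csum_scal, !IH, Nat.sub_diag.
    rewrite (iq_S q M) by assumption.
    replace (M + S c)%nat with (S M + c)%nat by lia.
    change (S M + c)%nat with (S (M + c)).
    rewrite (iq_S q (M + c)) by assumption.
    simpl; ring.
Qed.

(** Bailey's lemma relative to [a = q^e], with both free parameters sent to infinity. For
    [s = j + t] one has [s^2 + e s = j^2 + e j + t^2 + (2j + e) t], so the sum over [t] is
    q-Vandermonde with [M = N - j] and [c = 2j + e]. *)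
Lemma bailey_step (q : C) (hq : regular q) (e N : nat) (alpha : nat -> C) :
  csum (S N) (fun s => q ^ (s * s + e * s) * iq q (N - s) *
    csum (S s) (fun j => alpha j * iq q (s - j) * iq q (s + e + j)))
  = csum (S N) (fun j =>
      alpha j * q ^ (j * j + e * j) * iq q (N - j) * iq q (N + e + j)).
Proof.
  set (F := fun r t => alpha r * q ^ (r * r + e * r) *
    (q ^ (t * t + (2 * r + e) * t) * iq q (N - r - t) * iq q t * iq q (t + (2 * r + e)))).
  transitivity (csum (S N) (fun s => csum (S s) (fun j => F j (s - j)%nat))).
  { apply csum_ext; intros s Hs; rewrite <- csum_scal; apply csum_ext; intros j Hj.
    unfold F.
    replace (N - j - (s - j))%nat with (N - s)%nat by lia.
    replace (s - j + (2 * j + e))%nat with (s + e + j)%nat by lia.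
    replace (s * s + e * s)%nat
      with (j * j + e * j + ((s - j) * (s - j) + (2 * j + e) * (s - j)))%nat.
    - rewrite !Cpow_add_r; ring.
    - assert (exists d, s = j + d)%nat as [d ->] by (exists (s - j)%nat; lia).
      replace (j + d - j)%nat with d by lia; ring. }
  rewrite csum_triangle; apply csum_ext; intros j Hj.
  replace (S N - j)%nat with (S (N - j)) by lia.
  unfold F; rewrite csum_scal, q_vandermonde by assumption.
  replace (N - j + (2 * j + e))%nat with (N + e + j)%nat by lia; ring.
Qed.

(* [iq q (n - j)] continued by [0] for [j > n], as if [1 / (q;q)_m = 0] for [m < 0]. *)
Definition rho (q : C) (n j : nat) : C := if (j <=? n)%nat then iq q (n - j) else 0.

Lemma rho_le (q : C) (n j : nat) : (j <= n)%nat -> rho q n j = iq q (n - j).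
Proof. intros H; unfold rho; destruct (Nat.leb_spec j n); [reflexivity|lia]. Qed.

Lemma rho_gt (q : C) (n j : nat) : (n < j)%nat -> rho q n j = 0.
Proof. intros H; unfold rho; destruct (Nat.leb_spec j n); [lia|reflexivity]. Qed.

(** Valid for every [j]: at [j = n] the factor vanishes, and beyond it both sides are [0]. This lets
    the telescoping sums run past [n]. *)
Lemma rho_S (q : C) (n j : nat) : regular q -> rho q n (S j) = (1 - q ^ (n - j)) * rho q n j.
Proof.
  intros hq; destruct (Nat.lt_trichotomy j n) as [H|[->|H]].
  - rewrite !rho_le by lia; replace (n - j)%nat with (S (n - S j)) by lia.
    apply iq_S; assumption.
  - rewrite rho_gt, Nat.sub_diag by lia; simpl; ring.
  - rewrite !rho_gt by lia; ring.
Qed.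

(* [theta Q x j = (-1)^j x^j Q^(j(j-1)/2)]; the bilateral summand of index [-j] is
   [theta Q (Q/x) j]. *)
Fixpoint theta (Q x : C) (j : nat) : C :=
  match j with
  | O => 1
  | S i => - theta Q x i * x * Q ^ i
  end.

Definition fold0 (Q x y : C) (j : nat) : C :=
  match j with
  | O => 1
  | S _ => theta Q x j + theta Q y j
  end.

(* Pairs [j] with [-1-j] instead of [-j]. *)
Definition fold1 (Q x y : C) (j : nat) : C := theta Q x j + theta Q y (S j).

(** * The finite triple product *)

Section FiniteTriple.

Variables x y Q : C.
Hypothesis hQ : Q = x * y.
Hypothesis regQ : regular Q.

(* Summand by summand this is a difference of consecutive values of the right-hand side. *)
Lemma triple_step1 (n k : nat) :
  csum (S k) (fun j =>
    (1 - Q * Q ^ (2 * n)) * (fold1 Q x y j * rho Q n j * iq Q (n + 1 + j))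
    + - (1 - y * Q ^ n) * (fold0 Q x y j * rho Q n j * iq Q (n + j)))
  = (theta Q y (S k) - y * Q ^ n * theta Q x (S k)) * rho Q n (S k) * iq Q (n + S k).
Proof.
  induction k as [|k IH].
  - unfold csum, fold1, fold0, theta.
    rewrite rho_S, !Nat.add_0_r, !Nat.add_1_r by assumption.
    rewrite (rho_le Q n 0), Nat.sub_0_r, (iq_S Q n) by (assumption || lia).
    replace (2 * n)%nat with (n + n)%nat by lia.
    rewrite Cpow_add_r, hQ; simpl; ring.
  - change (csum (S (S k)) ?f) with (csum (S k) f + f (S k)); rewrite IH; cbv beta; clear IH.
    destruct (Nat.le_gt_cases (S k) n) as [H|H].
    + rewrite (rho_S Q n (S k)) by assumption.
      unfold fold1, fold0.
      replace (n + 1 + S k)%nat with (S (n + S k)) by lia.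
      replace (n + S (S k))%nat with (S (n + S k)) by lia.
      rewrite (iq_S Q (n + S k)) by assumption.
      change (theta Q y (S (S k))) with (- theta Q y (S k) * y * Q ^ S k).
      change (theta Q x (S (S k))) with (- theta Q x (S k) * x * Q ^ S k).
      replace (2 * n)%nat with (n + n)%nat by lia.
      rewrite !Cpow_add_r, (Cpow_sub_split Q n (S k)) by assumption.
      (* With [Q ^ n = p * w] and [Q = x * y] the step is a polynomial identity; the abbreviations
         keep the powers and theta terms as atoms. *)
      set (w := Q ^ (n - S k)); set (p := Q ^ S k).
      set (a := theta Q x (S k)); set (b := theta Q y (S k)).
      rewrite hQ; ring.
    + rewrite !(rho_gt Q n) by lia; ring.
Qed.

(** The companion telescoping sum: [triple_step1] passes from [tsum0 n] to [tsum1 n], this one from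
    [tsum1 n] to [tsum0 (S n)]. *)
Lemma triple_step2 (n k : nat) :
  csum (S k) (fun j =>
    (1 - Q * Q ^ (2 * n + 1)) * (fold0 Q x y j * rho Q (S n) j * iq Q (S n + j))
    + - (1 - x * Q ^ n) * (fold1 Q x y j * rho Q n j * iq Q (n + 1 + j)))
  = (x * Q ^ n * theta Q x k - theta Q y (S k)) * rho Q n k * iq Q (n + 1 + k).
Proof.
  induction k as [|k IH].
  - unfold csum, fold1, fold0, theta.
    rewrite !rho_le, !Nat.add_0_r, !Nat.add_1_r, !Nat.sub_0_r, (iq_S Q n) by (assumption || lia).
    replace (2 * n)%nat with (n + n)%nat by lia.
    simpl Cpow; rewrite Cpow_add_r, hQ; ring.
  - change (csum (S (S k)) ?f) with (csum (S k) f + f (S k)); rewrite IH; cbv beta; clear IH.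
    change (rho Q (S n) (S k)) with (rho Q n k).
    destruct (Nat.le_gt_cases k n) as [H|H].
    + rewrite (rho_S Q n k) by assumption.
      unfold fold1, fold0.
      replace (S n + S k)%nat with (S (n + 1 + k)) by lia.
      replace (n + 1 + S k)%nat with (S (n + 1 + k)) by lia.
      rewrite (iq_S Q (n + 1 + k)) by assumption.
      change (theta Q y (S (S k))) with (- theta Q y (S k) * y * Q ^ S k).
      change (theta Q x (S k)) with (- theta Q x k * x * Q ^ k).
      change (theta Q y (S k)) with (- theta Q y k * y * Q ^ k).
      replace (2 * n + 1)%nat with (n + n + 1)%nat by lia.
      rewrite !Cpow_add_r, !Cpow_S, (Cpow_sub_split Q n k) by assumption.
      set (w := Q ^ (n - k)); set (p := Q ^ k).
      set (a := theta Q x k); set (b := theta Q y k).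
      rewrite hQ; ring.
    + rewrite (rho_S Q n k), !(rho_gt Q n) by (assumption || lia); ring.
Qed.

(** Unfolded, the bilateral sum over [-n <= j <= n] of [(-1)^j x^j Q^(j(j-1)/2) / ((Q;Q)_(n-j)
    (Q;Q)_(n+j))]. In [tsum1] the range is [-n-1 <= j <= n] and the second index [n+1+j], which is
    symmetric under [j -> -1-j]. *)
Definition tsum0 (n : nat) : C :=
  csum (S n) (fun j => fold0 Q x y j * iq Q (n - j) * iq Q (n + j)).

Definition tsum1 (n : nat) : C :=
  csum (S n) (fun j => fold1 Q x y j * iq Q (n - j) * iq Q (n + 1 + j)).

Lemma tsum0_rho (n : nat) :
  tsum0 n = csum (S n) (fun j => fold0 Q x y j * rho Q n j * iq Q (n + j)).
Proof. apply csum_ext; intros j Hj; rewrite rho_le by lia; reflexivity. Qed.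

Lemma tsum1_rho (n : nat) :
  tsum1 n = csum (S n) (fun j => fold1 Q x y j * rho Q n j * iq Q (n + 1 + j)).
Proof. apply csum_ext; intros j Hj; rewrite rho_le by lia; reflexivity. Qed.

Lemma tsum1_rec (n : nat) : (1 - Q * Q ^ (2 * n)) * tsum1 n = (1 - y * Q ^ n) * tsum0 n.
Proof.
  (* At [k = n] the boundary term carries [rho Q n (S n) = 0]. *)
  pose proof (triple_step1 n n) as H.
  rewrite csum_lin, rho_gt in H by lia.
  rewrite tsum0_rho, tsum1_rho.
  match type of H with ?l - ?r = _ => transitivity (l - r + r); [ring|] end.
  rewrite H; ring.
Qed.

Lemma tsum0_rec (n : nat) :
  (1 - Q * Q ^ (2 * n + 1)) * tsum0 (S n) = (1 - x * Q ^ n) * tsum1 n.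
Proof.
  (* The choice [k = S n] completes the sum for [tsum0 (S n)]; the sum for [tsum1 n] then has one
     extra term, which [rho] makes [0], like the boundary term. *)
  pose proof (triple_step2 n (S n)) as H.
  rewrite csum_lin, rho_gt in H by lia.
  rewrite tsum0_rho, tsum1_rho.
  change (csum (S (S n)) (fun j => fold1 Q x y j * rho Q n j * iq Q (n + 1 + j)))
    with (csum (S n) (fun j => fold1 Q x y j * rho Q n j * iq Q (n + 1 + j))
          + fold1 Q x y (S n) * rho Q n (S n) * iq Q (n + 1 + S n)) in H.
  rewrite (rho_gt Q n (S n)) in H by lia.
  match type of H with ?l - ?a * (?s + _) = _ => transitivity (l - a * s + a * s); [ring|];
    transitivity (l - a * (s + fold1 Q x y (S n) * 0 * iq Q (n + 1 + S n)) + a * s); [ring|]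
  end.
  rewrite H; ring.
Qed.

(** The two recurrences together multiply [tsum0 n] by [(1 - x Q^n)(1 - y Q^n) / ((1 - Q^(2n+1))(1 -
    Q^(2n+2)))], the ratio of consecutive right-hand sides. *)
Lemma finite_triple0 (n : nat) :
  tsum0 n = qpoch x Q n * qpoch y Q n * iq Q (2 * n).
Proof.
  induction n as [|n IH].
  - unfold tsum0; simpl; rewrite iq_0; ring.
  - apply (regular_cancel Q (2 * n + 1)); [assumption|].
    rewrite tsum0_rec.
    apply (regular_cancel Q (2 * n)); [assumption|].
    transitivity ((1 - x * Q ^ n) * ((1 - Q * Q ^ (2 * n)) * tsum1 n)); [ring|].
    rewrite tsum1_rec, IH, (iq_S Q (2 * n)), (iq_S Q (S (2 * n))) by assumption.
    replace (2 * n + 1)%nat with (S (2 * n)) by lia.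
    replace (2 * S n)%nat with (S (S (2 * n))) by lia.
    simpl qpoch; ring.
Qed.

Lemma finite_triple1 (n : nat) :
  tsum1 n = qpoch x Q n * qpoch y Q (S n) * iq Q (S (2 * n)).
Proof.
  apply (regular_cancel Q (2 * n)); [assumption|].
  rewrite tsum1_rec, finite_triple0, (iq_S Q (2 * n)) by assumption.
  simpl qpoch; ring.
Qed.

End FiniteTriple.

Lemma csum_swap (m n : nat) (f : nat -> nat -> C) :
  csum m (fun i => csum n (fun j => f i j)) = csum n (fun j => csum m (fun i => f i j)).
Proof.
  induction m as [|m IH]; simpl.
  - symmetry; apply csum_zero; reflexivity.
  - rewrite IH, <- csum_plus; reflexivity.
Qed.

(** The remainder keeps the original index and range, so termwise bounds apply to it unchanged. *)
Lemma csum_tail (m N : nat) (f : nat -> C) : (m <= N)%nat ->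
  csum N f = csum m f + csum N (fun k => if (m <=? k)%nat then f k else 0).
Proof.
  induction N as [|N IH]; intros H.
  - replace m with 0%nat by lia; simpl; ring.
  - destruct (Nat.eq_dec m (S N)) as [->|Hm].
    + rewrite (csum_zero _ (fun k => if (S N <=? k)%nat then f k else 0)); [ring|].
      intros k Hk; destruct (Nat.leb_spec (S N) k); [lia|reflexivity].
    + simpl; rewrite IH by lia.
      destruct (Nat.leb_spec m N); [ring|lia].
Qed.

(** * Reduction to a single sum *)

Section DoubleSum.

Variable q : C.
Hypothesis regq : regular q.
Hypothesis regq2 : regular (q ^ 2).

(** The number [i(i-1)/2], by recursion to avoid a division. *)
Fixpoint tri (i : nat) : nat :=
  match i with
  | O => O
  | S k => tri k + k
  end.

Lemma tri_double (i : nat) : (2 * tri i + i = i * i)%nat.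
Proof. induction i as [|i IH]; simpl in *; lia. Qed.

(* The coefficient of [z^i] in [(-z;q)_oo]. *)
Definition euler_coef (i : nat) : C := q ^ tri i * iq q i.

(** The recurrence that [F(z) = (1 + z) F(qz)] imposes on the coefficients of [F(z) = (-z;q)_oo]. *)
Lemma euler_coef_S (i : nat) : (1 - q * q ^ i) * euler_coef (S i) = q ^ i * euler_coef i.
Proof.
  unfold euler_coef; rewrite (iq_S q i) by assumption; simpl tri.
  rewrite Cpow_add_r; ring.
Qed.

(** The coefficient of [z^n] in [z^(2j) (-z;q)_oo]. The test is essential: for [n < 2j] truncated
    subtraction would give [euler_coef 0 = 1]. *)
Definition euler_shift (n j : nat) : C := if (2 * j <=? n)%nat then euler_coef (n - 2 * j) else 0.

Lemma euler_shift_gt (n j : nat) : (n < 2 * j)%nat -> euler_shift n j = 0.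
Proof. intros H; unfold euler_shift; destruct (Nat.leb_spec (2 * j) n); [lia|reflexivity]. Qed.

Lemma euler_shift_SS (n j : nat) : euler_shift (S (S n)) (S j) = euler_shift n j.
Proof.
  unfold euler_shift.
  destruct (Nat.leb_spec (2 * S j) (S (S n))), (Nat.leb_spec (2 * j) n);
    try lia; f_equal; lia.
Qed.

(** This is [euler_coef_S] at [i = n - 1 - 2j]. The value [euler_shift (S n) (S j)] stands for index
    [n - 1] at [j], and stays correct at [n = 0]; at [n = 2j] both sides vanish. *)
Lemma euler_shift_rec (n j : nat) :
  (1 - q ^ (n - 2 * j)) * euler_shift n j = q ^ (n - 1 - 2 * j) * euler_shift (S n) (S j).
Proof.
  destruct (Nat.le_gt_cases (2 * j) n) as [H|H].
  2: { rewrite !euler_shift_gt by lia; ring. }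
  destruct (Nat.eq_dec n (2 * j)) as [->|Hn].
  - rewrite Nat.sub_diag, (euler_shift_gt (S _)) by lia; simpl; ring.
  - destruct n as [|n]; [lia|].
    rewrite euler_shift_SS; unfold euler_shift.
    destruct (Nat.leb_spec (2 * j) (S n)); [|lia].
    destruct (Nat.leb_spec (2 * j) n); [|lia].
    replace (S n - 2 * j)%nat with (S (n - 2 * j)) by lia.
    replace (S n - 1 - 2 * j)%nat with (n - 2 * j)%nat by lia.
    apply euler_coef_S.
Qed.

(** Shaped for telescoping: after multiplication by [iq (q ^ 2) j], the factor [1 - q ^ (2 * j)]
    lowers the index of [iq], and the first term on the right becomes the second one at [j - 1]. *)
Lemma euler_shift_term (n j : nat) :
  (1 - q ^ S n) * euler_shift (S n) j - euler_shift n j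
  = q ^ (S n - 2 * j) * (1 - q ^ (2 * j)) * euler_shift (S n) j
    - q ^ (n - 1 - 2 * j) * euler_shift (S n) (S j).
Proof.
  rewrite <- euler_shift_rec.
  assert (H1 : (1 - q ^ (S n - 2 * j)) * euler_shift (S n) j = q ^ (n - 2 * j) * euler_shift n j).
  { rewrite euler_shift_rec, euler_shift_SS; do 2 f_equal; lia. }
  assert (H2 : q ^ S n * euler_shift (S n) j = q ^ (2 * j) * q ^ (S n - 2 * j) * euler_shift (S n) j).
  { destruct (Nat.le_gt_cases (2 * j) (S n)).
    - rewrite (Cpow_sub_split q (S n) (2 * j)) by assumption; ring.
    - rewrite euler_shift_gt by assumption; ring. }
  transitivity (euler_shift (S n) j - q ^ S n * euler_shift (S n) j - euler_shift n j); [ring|].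
  rewrite H2.
  transitivity ((1 - q ^ (S n - 2 * j)) * euler_shift (S n) j
    + q ^ (S n - 2 * j) * (1 - q ^ (2 * j)) * euler_shift (S n) j - euler_shift n j); [ring|].
  rewrite H1; ring.
Qed.

Lemma euler_shift_telescope (n k : nat) :
  csum (S k) (fun j => ((1 - q ^ S n) * euler_shift (S n) j - euler_shift n j) * iq (q ^ 2) j)
  = - (q ^ (n - 1 - 2 * k) * euler_shift (S n) (S k) * iq (q ^ 2) k).
Proof.
  induction k as [|k IH].
  - unfold csum; rewrite euler_shift_term, iq_0; simpl; ring.
  - change (csum (S (S k)) ?f) with (csum (S k) f + f (S k)); rewrite IH, euler_shift_term.
    rewrite (iq_S (q ^ 2) k) by assumption.
    replace (S n - 2 * S k)%nat with (n - 1 - 2 * k)%nat by lia.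
    rewrite !(Cpow_mult_r q 2); simpl Cpow; ring.
Qed.

(* The coefficients of [(-z;q)_oo / (z^2;q^2)_oo = 1 / (z;q)_oo]. *)
Lemma sum_euler_shift (n : nat) : csum (S n) (fun j => euler_shift n j * iq (q ^ 2) j) = iq q n.
Proof.
  induction n as [|n IH].
  - unfold csum, euler_shift, euler_coef; simpl; rewrite !iq_0; ring.
  - apply (regular_cancel q n); [assumption|].
    rewrite <- (iq_S q n), <- IH, <- csum_scal by assumption.
    transitivity (csum (S (S n)) (fun j => euler_shift n j * iq (q ^ 2) j)).
    2: { simpl csum at 1; rewrite (euler_shift_gt n (S n)) by lia; simpl; ring. }
    (* Only the boundary term survives, and it is [0] because [2(n+2) > n+1]. *)
    pose proof (euler_shift_telescope n (S n)) as H.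
    rewrite (euler_shift_gt (S n) (S (S n))) in H by lia.
    rewrite (csum_ext _ _ (fun j =>
      ((1 - q ^ S n) * euler_shift (S n) j - euler_shift n j) * iq (q ^ 2) j
      + euler_shift n j * iq (q ^ 2) j)) by (intros; simpl; ring).
    rewrite csum_plus, H; ring.
Qed.

(** The pairs with [i + 2j < N], by rows and by lines [i + 2j = n]; truncated subtraction makes the
    rows with [2j >= N] empty. *)
Lemma csum_weighted_triangle (N : nat) (f : nat -> nat -> C) :
  csum N (fun j => csum (N - 2 * j) (fun i => f i j))
  = csum N (fun n => csum (S n) (fun j => if (2 * j <=? n)%nat then f (n - 2 * j)%nat j else 0)).
Proof.
  induction N as [|N IH]; [reflexivity|].
  change (csum (S N) ?f) with (csum N f + f N).
  rewrite <- IH.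
  change (csum (S N) ?f) with (csum N f + f N).
  rewrite (csum_ext N (fun j => csum (S N - 2 * j) _)
    (fun j => csum (N - 2 * j) (fun i => f i j)
              + (if (2 * j <=? N)%nat then f (N - 2 * j)%nat j else 0))).
  - rewrite csum_plus.
    destruct N as [|N]; [simpl; ring|].
    destruct (Nat.leb_spec (2 * S N) (S N)); [lia|].
    replace (S (S N) - 2 * S N)%nat with 0%nat by lia; simpl; ring.
  - intros j Hj; destruct (Nat.leb_spec (2 * j) N).
    + replace (S N - 2 * j)%nat with (S (N - 2 * j)) by lia; reflexivity.
    + replace (S N - 2 * j)%nat with 0%nat by lia.
      replace (N - 2 * j)%nat with 0%nat by lia; simpl; ring.
Qed.

(** The weight [q^(n^2 + e n)] is constant on each line [i + 2j = n], where [sum_euler_shift]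
    evaluates the rest. *)
Lemma double_to_single (e N : nat) :
  csum N (fun j => csum (N - 2 * j) (fun i =>
    q ^ ((i + 2 * j) * (i + 2 * j) + e * (i + 2 * j)) * euler_coef i * iq (q ^ 2) j))
  = csum N (fun n => q ^ (n * n + e * n) * iq q n).
Proof.
  rewrite csum_weighted_triangle; apply csum_ext; intros n Hn.
  rewrite <- sum_euler_shift, <- csum_scal; apply csum_ext; intros j Hj.
  unfold euler_shift; destruct (Nat.leb_spec (2 * j) n); [|ring].
  replace (n - 2 * j + 2 * j)%nat with n by lia; ring.
Qed.

End DoubleSum.

(** * The Bailey chain and the finite Rogers-Ramanujan identities *)

(** The parameter [e] selects Bailey pairs relative to [a = 1] or [a = q], so that both identities
    share one proof. *)
Definition fold_theta (e : nat) : C -> C -> C -> nat -> C :=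
  match e with O => fold0 | S _ => fold1 end.

Lemma finite_triple (x y Q : C) (e n : nat) : Q = x * y -> regular Q -> (e <= 1)%nat ->
  csum (S n) (fun j => fold_theta e Q x y j * iq Q (n - j) * iq Q (n + e + j))
  = qpoch x Q n * qpoch y Q (n + e) * iq Q (2 * n + e).
Proof.
  intros hQ reg he; destruct e as [|[|e]]; [| |lia]; simpl fold_theta.
  - rewrite !Nat.add_0_r, <- finite_triple0 by assumption; reflexivity.
  - rewrite !Nat.add_1_r, <- finite_triple1 by assumption.
    unfold tsum1; rewrite Nat.add_1_r; reflexivity.
Qed.

Lemma qpoch_1 (q : C) (n : nat) : qpoch 1 q (S n) = 0.
Proof. induction n as [|n IH]; simpl in *; [|rewrite IH]; ring. Qed.

(** First Bailey step, applied to the unit pair: for [x = 1] the finite triple product contains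
    [(1;q)_s], which kills every [s] except [s = 0]. *)
Lemma bailey_unit (q : C) (e N : nat) : regular q -> (e <= 1)%nat ->
  csum (S N) (fun j => fold_theta e q 1 q j * q ^ (j * j + e * j)
                       * iq q (N - j) * iq q (N + e + j)) = iq q N.
Proof.
  intros hq he.
  rewrite <- bailey_step by assumption.
  rewrite csum_shift, (csum_zero N); cbv beta.
  - rewrite finite_triple by (assumption || ring).
    rewrite Nat.sub_0_r, !Nat.mul_0_r; unfold iq; simpl.
    field; split; auto using qpoch_neq_0.
  - intros k Hk; rewrite finite_triple, qpoch_1 by (assumption || ring); ring.
Qed.

(** Second Bailey step: [bailey_unit] expands [iq q s] as the inner sum of [bailey_step], and the
    step contributes another [q^(j^2 + e j)]. *)
Lemma finite_rogers_ramanujan (q : C) (e N : nat) : regular q -> (e <= 1)%nat ->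
  csum (S N) (fun s => q ^ (s * s + e * s) * iq q s * iq q (N - s))
  = csum (S N) (fun j => fold_theta e q 1 q j * q ^ (2 * (j * j + e * j))
                         * iq q (N - j) * iq q (N + e + j)).
Proof.
  intros hq he.
  rewrite (csum_ext _ _ (fun s => q ^ (s * s + e * s) * iq q (N - s) *
    csum (S s) (fun j => (fold_theta e q 1 q j * q ^ (j * j + e * j))
                         * iq q (s - j) * iq q (s + e + j))))
    by (intros; rewrite bailey_unit by assumption; ring).
  rewrite bailey_step by assumption; apply csum_ext; intros j Hj.
  replace (2 * (j * j + e * j))%nat with ((j * j + e * j) + (j * j + e * j))%nat by lia.
  rewrite (Cpow_add_r q (j * j + e * j)); ring.
Qed.

(** * Theta coefficients in base [q ^ 5] *)

Lemma Cpow5_pow (q : C) (j : nat) : (q ^ 5) ^ j = q ^ (4 * j) * q ^ j.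
Proof. rewrite <- Cpow_mult_r, <- Cpow_add_r; f_equal; lia. Qed.

(** The exponents agree: [2j^2 + j(j-1)/2 = 5j(j-1)/2 + 2j] and
    [2j^2 + j(j+1)/2 = 5j(j-1)/2 + 3j]. *)
Lemma fold_theta_q5_0 (q : C) (j : nat) :
  fold_theta 0 (q ^ 5) (q ^ 2) (q ^ 3) j = fold_theta 0 q 1 q j * q ^ (2 * (j * j)).
Proof.
  assert (H : theta (q ^ 5) (q ^ 2) j = theta q 1 j * q ^ (2 * (j * j)) /\
              theta (q ^ 5) (q ^ 3) j = theta q q j * q ^ (2 * (j * j))).
  { induction j as [|j [IH1 IH2]]; [simpl; split; ring|].
    change (theta (q ^ 5) (q ^ 2) (S j)) with (- theta (q ^ 5) (q ^ 2) j * q ^ 2 * (q ^ 5) ^ j).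
    change (theta (q ^ 5) (q ^ 3) (S j)) with (- theta (q ^ 5) (q ^ 3) j * q ^ 3 * (q ^ 5) ^ j).
    change (theta q 1 (S j)) with (- theta q 1 j * 1 * q ^ j).
    change (theta q q (S j)) with (- theta q q j * q * q ^ j).
    rewrite IH1, IH2.
    replace (2 * (S j * S j))%nat with (2 * (j * j) + 4 * j + 2)%nat by lia.
    rewrite !Cpow_add_r, Cpow5_pow.
    split; ring. }
  destruct H as [H1 H2]; destruct j; unfold fold_theta, fold0; [simpl; ring|].
  rewrite H1, H2; ring.
Qed.

(** Here [2j(j+1) + j(j-1)/2 = 5j(j-1)/2 + 4j]; the same multiplier serves the partner index, since
    [j(j+1)] is invariant under [j -> -1-j]. *)
Lemma fold_theta_q5_1 (q : C) (j : nat) :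
  fold_theta 1 (q ^ 5) (q ^ 4) q j = fold_theta 1 q 1 q j * q ^ (2 * (j * j + j)).
Proof.
  assert (H : theta (q ^ 5) (q ^ 4) j = theta q 1 j * q ^ (2 * (j * j + j)) /\
              theta (q ^ 5) q (S j) = theta q q (S j) * q ^ (2 * (j * j + j))).
  { induction j as [|j [IH1 IH2]]; [simpl; split; ring|].
    change (theta (q ^ 5) (q ^ 4) (S j)) with (- theta (q ^ 5) (q ^ 4) j * q ^ 4 * (q ^ 5) ^ j).
    change (theta (q ^ 5) q (S (S j))) with (- theta (q ^ 5) q (S j) * q * (q ^ 5 * (q ^ 5) ^ j)).
    change (theta q 1 (S j)) with (- theta q 1 j * 1 * q ^ j).
    change (theta q q (S (S j))) with (- theta q q (S j) * q * (q * q ^ j)).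
    rewrite IH1, IH2.
    replace (2 * (S j * S j + S j))%nat with (2 * (j * j + j) + 4 * j + 4)%nat by lia.
    rewrite !Cpow_add_r, Cpow5_pow.
    split; ring. }
  destruct H as [H1 H2]; unfold fold_theta, fold1; rewrite H1, H2; ring.
Qed.

(** * Convergence in [C] through the modulus *)

Lemma filterlim_C_iff (u : nat -> C) (l : C) :
  filterlim u eventually (locally l) <->
  forall eps : R, (0 < eps)%R ->
    exists N, forall n, (N <= n)%nat -> (Cmod (u n - l) < eps)%R.
Proof.
  split.
  - intros H eps heps.
    (* The balls of [C] are those of a product, hence squares; passing to the Euclidean modulus
       costs a factor [sqrt 2]. *)
    assert (h2 : (0 < eps / sqrt 2)%R).
    { apply Rdiv_lt_0_compat; [assumption|]; apply sqrt_lt_R0; lra. }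
    destruct (proj1 (filterlim_locally u l) H (mkposreal _ h2)) as [N hN].
    exists N; intros n hn.
    pose proof (C_NormedModule_mixin_compat2 l (u n) _ (hN n hn)) as B; simpl in B.
    replace (sqrt 2 * (eps / sqrt 2))%R with eps in B; [exact B|].
    field; pose proof (sqrt_lt_R0 2); lra.
  - intros H; apply filterlim_locally; intros eps.
    destruct (H eps (cond_pos eps)) as [N hN].
    exists N; intros n hn; apply C_NormedModule_mixin_compat1; exact (hN n hn).
Qed.

Lemma exp_le (x y : R) : (x <= y)%R -> (exp x <= exp y)%R.
Proof. intros [H| ->]; [left; apply exp_increasing; assumption|right; reflexivity]. Qed.

(** * Limits at a geometric rate *)

Section Geometric.

Variable r : R.
Hypothesis hr0 : (0 <= r)%R.
Hypothesis hr1 : (r < 1)%R.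

(** The bound is imposed from [n = 0] on, so it also yields [0 <= K] and a bound on the whole
    sequence. *)
Definition gconv (u : nat -> C) (l : C) : Prop :=
  exists K : R, forall n, (Cmod (u n - l) <= K * r ^ n)%R.

Lemma rpow_bounds (n : nat) : (0 <= r ^ n <= 1)%R.
Proof.
  split; [apply pow_le; assumption|].
  rewrite <- (pow1 n); apply pow_incr; lra.
Qed.

Lemma rpow_anti (m n : nat) : (m <= n)%nat -> (r ^ n <= r ^ m)%R.
Proof.
  intros H; replace n with (m + (n - m))%nat by lia; rewrite pow_add.
  pose proof (rpow_bounds m); pose proof (rpow_bounds (n - m)); nra.
Qed.

Lemma gconv_const_nonneg (u : nat -> C) (l : C) (K : R) :
  (forall n, Cmod (u n - l) <= K * r ^ n)%R -> (0 <= K)%R.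
Proof.
  intros H; specialize (H O); pose proof (Cmod_ge_0 (u O - l)); simpl in H; lra.
Qed.

Lemma gconv_filterlim (u : nat -> C) (l : C) :
  gconv u l -> filterlim u eventually (locally l).
Proof.
  intros [K hK]; pose proof (gconv_const_nonneg _ _ _ hK) as K0.
  apply filterlim_C_iff; intros eps heps.
  assert (h : (0 < eps / (K + 1))%R) by (apply Rdiv_lt_0_compat; lra).
  destruct (pow_lt_1_zero r) with (y := (eps / (K + 1))%R) as [N hN].
  - rewrite Rabs_pos_eq; assumption.
  - assumption.
  - exists N; intros n hn; specialize (hN n hn); specialize (hK n).
    rewrite Rabs_pos_eq in hN by apply rpow_bounds.
    pose proof (rpow_bounds n).
    apply Rle_lt_trans with (1 := hK).
    apply Rle_lt_trans with ((K + 1) * r ^ n)%R; [nra|].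
    replace eps with ((K + 1) * (eps / (K + 1)))%R by (field; lra).
    apply Rmult_lt_compat_l; lra.
Qed.

Lemma gconv_unique (u : nat -> C) (l l' : C) : gconv u l -> gconv u l' -> l = l'.
Proof.
  intros H H'.
  apply gconv_filterlim in H; apply gconv_filterlim in H'.
  exact (filterlim_locally_unique (F := eventually) (V := C_NormedModule) u l l' H H').
Qed.

Lemma gconv_ext (u v : nat -> C) (l : C) : (forall n, u n = v n) -> gconv u l -> gconv v l.
Proof. intros E [K hK]; exists K; intros n; rewrite <- E; apply hK. Qed.

Lemma gconv_const (c : C) : gconv (fun _ => c) c.
Proof.
  exists 0%R; intros n; replace (c - c) with (RtoC 0) by ring; rewrite Cmod_0; lra.
Qed.

Lemma Cmod_le_add (a b : C) : (Cmod a <= Cmod b + Cmod (a - b))%R.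
Proof.
  replace a with (b + (a - b)) at 1 by ring; apply Cmod_triangle.
Qed.

Lemma gconv_bounded (u : nat -> C) (l : C) :
  gconv u l -> exists M, forall n, (Cmod (u n) <= M)%R.
Proof.
  intros [K hK]; pose proof (gconv_const_nonneg _ _ _ hK).
  exists (Cmod l + K)%R; intros n.
  apply Rle_trans with (1 := Cmod_le_add (u n) l).
  specialize (hK n); pose proof (rpow_bounds n); nra.
Qed.

Lemma gconv_comp (u : nat -> C) (l : C) (phi : nat -> nat) :
  (forall n, n <= phi n)%nat -> gconv u l -> gconv (fun n => u (phi n)) l.
Proof.
  intros hphi [K hK]; pose proof (gconv_const_nonneg _ _ _ hK).
  exists K; intros n; apply Rle_trans with (1 := hK (phi n)).
  apply Rmult_le_compat_l; [assumption|]; apply rpow_anti, hphi.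
Qed.

Lemma gconv_mult (u v : nat -> C) (l m : C) :
  gconv u l -> gconv v m -> gconv (fun n => u n * v n) (l * m).
Proof.
  intros Hu [Kv hv]; destruct (gconv_bounded _ _ Hu) as [M hM]; destruct Hu as [Ku hu].
  exists (M * Kv + Cmod m * Ku)%R; intros n.
  replace (u n * v n - l * m) with (u n * (v n - m) + m * (u n - l)) by ring.
  apply Rle_trans with (1 := Cmod_triangle _ _); rewrite !Cmod_mult.
  specialize (hv n); specialize (hu n); specialize (hM n).
  pose proof (Cmod_ge_0 (u n)); pose proof (Cmod_ge_0 m); pose proof (Cmod_ge_0 (v n - m)).
  rewrite Rmult_plus_distr_r, !Rmult_assoc.
  apply Rplus_le_compat; apply Rmult_le_compat; auto using Cmod_ge_0; lra.
Qed.

(** The limit cannot be [0]: with reciprocals bounded by [M], the constant [1 = / u n * u n] would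
    tend to [0]. *)
Lemma gconv_inv (u : nat -> C) (l : C) (M : R) :
  (forall n, u n <> 0) -> (forall n, Cmod (/ u n) <= M)%R -> gconv u l ->
  l <> 0 /\ gconv (fun n => / u n) (/ l).
Proof.
  intros hn hM H.
  assert (hl : l <> 0).
  { intros ->; apply C1_nz; apply (gconv_unique (fun _ => 1)); [apply gconv_const|].
    destruct H as [K hK]; exists (M * K)%R; intros n.
    replace (1 - 0) with (/ u n * (u n - 0)) by (field; apply hn).
    rewrite Cmod_mult, Rmult_assoc.
    apply Rmult_le_compat; auto using Cmod_ge_0. }
  split; [assumption|].
  destruct H as [K hK]; exists (M * Cmod (/ l) * K)%R; intros n.
  replace (/ u n - / l) with (/ u n * / l * - (u n - l)) by (field; auto).
  rewrite !Cmod_mult, Cmod_opp, Rmult_assoc.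
  apply Rle_trans with (M * Cmod (/ l) * Cmod (u n - l))%R.
  - rewrite <- Rmult_assoc; apply Rmult_le_compat_r; [apply Cmod_ge_0|].
    apply Rmult_le_compat_r; auto using Cmod_ge_0.
  - rewrite (Rmult_assoc _ K); apply Rmult_le_compat_l; [|apply hK].
    apply Rmult_le_pos; [|apply Cmod_ge_0].
    apply Rle_trans with (2 := hM O), Cmod_ge_0.
Qed.

Lemma Cmod_csum_geom (A : R) (N : nat) (f : nat -> C) :
  (forall k, (k < N)%nat -> Cmod (f k) <= A * r ^ k)%R ->
  (Cmod (csum N f) <= A * ((1 - r ^ N) / (1 - r)))%R.
Proof.
  induction N as [|N IH]; intros H.
  - simpl; rewrite Cmod_0; apply Req_le; field; lra.
  - simpl csum; apply Rle_trans with (1 := Cmod_triangle _ _).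
    apply Rle_trans with (A * ((1 - r ^ N) / (1 - r)) + A * r ^ N)%R.
    + apply Rplus_le_compat; [apply IH; auto with arith|apply H; lia].
    + apply Req_le; simpl; field; lra.
Qed.

Lemma Cmod_csum_le (A : R) (N : nat) (f : nat -> C) : (0 <= A)%R ->
  (forall k, (k < N)%nat -> Cmod (f k) <= A * r ^ k)%R ->
  (Cmod (csum N f) <= A / (1 - r))%R.
Proof.
  intros hA H; apply Rle_trans with (1 := Cmod_csum_geom A N f H).
  apply Rmult_le_compat_l; [assumption|].
  pose proof (rpow_bounds N).
  assert (0 < / (1 - r))%R by (apply Rinv_0_lt_compat; lra).
  unfold Rdiv; nra.
Qed.

Lemma gconv_exists (A : R) (u : nat -> C) :
  (forall n, Cmod (u (S n) - u n) <= A * r ^ n)%R -> exists l, gconv u l.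
Proof.
  intros H.
  assert (hA : (0 <= A)%R).
  { specialize (H O); pose proof (Cmod_ge_0 (u 1%nat - u O)); simpl in H; lra. }
  assert (D : forall n m, (Cmod (u (n + m)%nat - u n) <= A / (1 - r) * r ^ n)%R).
  { intros n m.
    replace (u (n + m)%nat - u n) with (csum m (fun k => u (S (n + k)) - u (n + k)%nat)).
    - replace (A / (1 - r) * r ^ n)%R with (A * r ^ n / (1 - r))%R by (field; lra).
      apply Cmod_csum_le.
      + apply Rmult_le_pos; [assumption|apply rpow_bounds].
      + intros k _; rewrite Rmult_assoc, <- pow_add; apply H.
    - induction m as [|m IH]; simpl.
      + rewrite Nat.add_0_r; ring.
      + rewrite IH, Nat.add_succ_r; ring. }
  assert (L : exists l : C, filterlim u eventually (locally l)).
  { apply (filterlim_locally_cauchy (U := CompleteNormedModule.CompleteSpace _ C_CompleteNormedModule)).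
    intros eps.
    (* [Z] supplies an [N] with [A / (1 - r) * r ^ N < eps / 2], the Cauchy estimate being given by
       [D]. *)
    assert (Z : gconv (fun n => RtoC (A / (1 - r) * r ^ n)) 0).
    { exists (A / (1 - r))%R; intros n.
      replace (RtoC (A / (1 - r) * r ^ n) - 0) with (RtoC (A / (1 - r) * r ^ n)) by ring.
      rewrite Cmod_R, Rabs_pos_eq; [lra|].
      apply Rmult_le_pos; [|apply rpow_bounds].
      apply Rmult_le_pos; [assumption|]; left; apply Rinv_0_lt_compat; lra. }
    apply gconv_filterlim in Z.
    destruct (proj1 (filterlim_C_iff _ _) Z (eps / 2)%R) as [N hN];
      [pose proof (cond_pos eps); lra|].
    specialize (hN N (le_n N)).
    replace (RtoC (A / (1 - r) * r ^ N) - 0) with (RtoC (A / (1 - r) * r ^ N)) in hN by ring.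
    rewrite Cmod_R in hN; pose proof (Rle_abs (A / (1 - r) * r ^ N)).
    exists (fun n => (N <= n)%nat); split; [exists N; auto|].
    intros i j hi hj; apply C_NormedModule_mixin_compat1.
    change (Cmod (u j - u i) < eps)%R.
    replace (u j - u i) with ((u j - u N) + - (u i - u N)) by ring.
    apply Rle_lt_trans with (1 := Cmod_triangle _ _); rewrite Cmod_opp.
    pose proof (D N (i - N)%nat) as D1; pose proof (D N (j - N)%nat) as D2.
    replace (N + (i - N))%nat with i in D1 by lia.
    replace (N + (j - N))%nat with j in D2 by lia.
    lra. }
  destruct L as [l hl]; exists l, (A / (1 - r))%R; intros n.
  (* The bound [D] is uniform in [m], so it passes to the limit and the rate is kept. *)
  apply le_epsilon; intros eps heps.
  destruct (proj1 (filterlim_C_iff _ _) hl eps heps) as [N hN].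
  specialize (hN (n + N)%nat ltac:(lia)); specialize (D n N).
  replace (u n - l) with (- (u (n + N)%nat - u n) + (u (n + N)%nat - l)) by ring.
  apply Rle_trans with (1 := Cmod_triangle _ _); rewrite Cmod_opp; lra.
Qed.

Lemma gconv_csum (A : R) (g : nat -> C) :
  (forall n, Cmod (g n) <= A * r ^ n)%R -> exists l, gconv (fun N => csum N g) l.
Proof.
  intros H; apply (gconv_exists A); intros n; simpl.
  replace (csum n g + g n - csum n g) with (g n) by ring; apply H.
Qed.

(** Decay of [g] at twice the rate is what makes this work: [r^(2s)] times the error [r^(N-s)] of
    [h] is [r^N r^s], summable over [s] with total of order [r^N]. *)
Lemma gconv_convolution (A : R) (g h k : nat -> C) (G H K : C) :
  (forall n, Cmod (g n) <= A * r ^ (2 * n))%R ->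
  gconv (fun N => csum N g) G -> gconv h H -> gconv k K ->
  gconv (fun N => csum (S N) (fun s => g s * h (N - s)%nat * k (N + s)%nat)) (G * (H * K)).
Proof.
  intros hg hG hh hk.
  assert (hA : (0 <= A)%R).
  { specialize (hg O); pose proof (Cmod_ge_0 (g O)); simpl in hg; lra. }
  destruct (gconv_bounded _ _ hk) as [M hM].
  destruct hG as [KG hG], hh as [Kh hh], hk as [Kk hk].
  pose proof (gconv_const_nonneg _ _ _ hh); pose proof (gconv_const_nonneg _ _ _ hk).
  pose proof (gconv_const_nonneg _ _ _ hG).
  assert (hM0 : (0 <= M)%R) by (apply Rle_trans with (2 := hM O), Cmod_ge_0).
  set (D := (Kh * M + Cmod H * Kk)%R).
  assert (hD : (0 <= D)%R).
  { unfold D; pose proof (Cmod_ge_0 H); apply Rplus_le_le_0_compat; apply Rmult_le_pos; assumption. }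
  exists (A * D / (1 - r) + KG * Cmod (H * K))%R; intros N.
  replace (csum (S N) (fun s => g s * h (N - s)%nat * k (N + s)%nat) - G * (H * K))
    with (csum (S N) (fun s => g s * (h (N - s)%nat * k (N + s)%nat - H * K))
          + (csum (S N) g - G) * (H * K)).
  2: { rewrite (csum_ext (S N) (fun s => g s * (h (N - s)%nat * k (N + s)%nat - H * K))
         (fun s => g s * h (N - s)%nat * k (N + s)%nat + - (H * K) * g s))
         by (intros; ring).
       rewrite csum_plus, csum_scal; ring. }
  apply Rle_trans with (1 := Cmod_triangle _ _).
  rewrite Rmult_plus_distr_r; apply Rplus_le_compat.
  - replace (A * D / (1 - r) * r ^ N)%R with (A * D * r ^ N / (1 - r))%R by (field; lra).
    apply Cmod_csum_le.
    + repeat apply Rmult_le_pos; auto; apply rpow_bounds.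
    + intros s hs; rewrite Cmod_mult.
      assert (B : (Cmod (h (N - s)%nat * k (N + s)%nat - H * K) <= D * r ^ (N - s))%R).
      { replace (h (N - s)%nat * k (N + s)%nat - H * K)
          with ((h (N - s)%nat - H) * k (N + s)%nat + H * (k (N + s)%nat - K)) by ring.
        apply Rle_trans with (1 := Cmod_triangle _ _); rewrite !Cmod_mult.
        unfold D; rewrite Rmult_plus_distr_r; apply Rplus_le_compat.
        - replace (Kh * M * r ^ (N - s))%R with (Kh * r ^ (N - s) * M)%R by ring.
          apply Rmult_le_compat; auto using Cmod_ge_0.
        - rewrite Rmult_assoc; apply Rmult_le_compat_l; [apply Cmod_ge_0|].
          apply Rle_trans with (1 := hk _), Rmult_le_compat_l; [assumption|].
          apply rpow_anti; lia. }
      apply Rle_trans with (A * r ^ (2 * s) * (D * r ^ (N - s)))%R.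
      * apply Rmult_le_compat; auto using Cmod_ge_0.
      * apply Req_le.
        replace (A * D * r ^ N * r ^ s)%R with (A * D * (r ^ N * r ^ s))%R by ring.
        replace (A * r ^ (2 * s) * (D * r ^ (N - s)))%R
          with (A * D * (r ^ (2 * s) * r ^ (N - s)))%R by ring.
        rewrite <- !pow_add; do 2 f_equal; lia.
  - rewrite Cmod_mult.
    replace (KG * Cmod (H * K) * r ^ N)%R with (KG * r ^ N * Cmod (H * K))%R by ring.
    apply Rmult_le_compat_r; [apply Cmod_ge_0|].
    apply Rle_trans with (1 := hG (S N)), Rmult_le_compat_l; [assumption|].
    apply rpow_anti; lia.
Qed.

Section Product.

Variables a Q : C.
Hypothesis ha : (Cmod a <= r)%R.
Hypothesis hQ : (Cmod Q <= r)%R.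

Lemma Cmod_factor (n : nat) : (Cmod (a * Q ^ n) <= r ^ S n)%R.
Proof.
  rewrite Cmod_mult, Cmod_pow; simpl.
  apply Rmult_le_compat; auto using Cmod_ge_0.
  - apply pow_le, Cmod_ge_0.
  - apply pow_incr; split; [apply Cmod_ge_0|assumption].
Qed.

(** From [1 + t <= exp t] on each factor. The exponent is the partial geometric sum, so that the
    induction closes. *)
Lemma qpoch_upper (n : nat) : (Cmod (qpoch a Q n) <= exp ((1 - r ^ n) / (1 - r)))%R.
Proof.
  induction n as [|n IH]; simpl qpoch.
  - rewrite Cmod_1; simpl; replace ((1 - 1) / (1 - r))%R with 0%R by (field; lra).
    rewrite exp_0; lra.
  - rewrite Cmod_mult.
    replace ((1 - r ^ S n) / (1 - r))%R with ((1 - r ^ n) / (1 - r) + r ^ n)%R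
      by (simpl; field; lra).
    rewrite exp_plus; apply Rmult_le_compat; auto using Cmod_ge_0.
    apply Rle_trans with (1 + r ^ n)%R; [|apply exp_ineq1_le].
    apply Rle_trans with (1 := Cmod_triangle _ _); rewrite Cmod_1, Cmod_opp.
    pose proof (Cmod_factor n); pose proof (rpow_anti n (S n) ltac:(lia)); lra.
Qed.

(** With [s = |a Q^n|], [1 / (1 - s) = 1 + s / (1 - s) <= exp (s / (1 - s))]; then [s <= r] in the
    denominator and [s <= r^n] in the numerator. *)
Lemma factor_lower (n : nat) : (/ exp (r ^ n / (1 - r)) <= Cmod (1 - a * Q ^ n))%R.
Proof.
  set (s := Cmod (a * Q ^ n)).
  pose proof (Cmod_factor n) as Hs; fold s in Hs.
  assert (s0 : (0 <= s)%R) by apply Cmod_ge_0.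
  assert (H1 : (r ^ S n <= r)%R) by (rewrite <- (pow_1 r) at 2; apply rpow_anti; lia).
  assert (H2 : (r ^ S n <= r ^ n)%R) by (apply rpow_anti; lia).
  assert (H3 : (1 - s <= Cmod (1 - a * Q ^ n))%R).
  { pose proof (Cmod_le_add 1 (1 - a * Q ^ n)) as T.
    replace (1 - (1 - a * Q ^ n)) with (a * Q ^ n) in T by ring.
    fold s in T; rewrite Cmod_1 in T; lra. }
  apply Rle_trans with (2 := H3).
  rewrite <- (Rinv_inv (1 - s)); apply Rinv_le_contravar.
  - apply Rinv_0_lt_compat; lra.
  - apply Rle_trans with (2 := exp_ineq1_le _).
    replace (/ (1 - s))%R with (1 + s * / (1 - s))%R by (field; lra).
    apply Rplus_le_compat_l; unfold Rdiv; apply Rmult_le_compat; try lra.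
    + left; apply Rinv_0_lt_compat; lra.
    + apply Rinv_le_contravar; lra.
Qed.

Lemma factor_neq_0 (n : nat) : 1 - a * Q ^ n <> 0.
Proof.
  apply Cmod_gt_0; apply Rlt_le_trans with (2 := factor_lower n).
  apply Rinv_0_lt_compat, exp_pos.
Qed.

Lemma qpoch_factors_neq_0 (n : nat) : qpoch a Q n <> 0.
Proof.
  induction n as [|n IH]; simpl; [apply C1_nz|apply Cmult_neq_0; auto using factor_neq_0].
Qed.

(** One division by [1 - r] comes from [factor_lower], the other from the geometric sum of its
    exponents. *)
Lemma qpoch_inv_upper (n : nat) :
  (Cmod (/ qpoch a Q n) <= exp ((1 - r ^ n) / (1 - r) / (1 - r)))%R.
Proof.
  rewrite Cmod_inv by apply qpoch_factors_neq_0.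
  induction n as [|n IH]; simpl qpoch.
  - rewrite Cmod_1, Rinv_1; simpl.
    replace ((1 - 1) / (1 - r) / (1 - r))%R with 0%R by (field; lra).
    rewrite exp_0; lra.
  - rewrite Cmod_mult, Rinv_mult.
    replace ((1 - r ^ S n) / (1 - r) / (1 - r))%R
      with ((1 - r ^ n) / (1 - r) / (1 - r) + r ^ n / (1 - r))%R by (simpl; field; lra).
    rewrite exp_plus; apply Rmult_le_compat; auto.
    + left; apply Rinv_0_lt_compat, Cmod_gt_0, qpoch_factors_neq_0.
    + left; apply Rinv_0_lt_compat, Cmod_gt_0, factor_neq_0.
    + rewrite <- (Rinv_inv (exp _)); apply Rinv_le_contravar; [|apply factor_lower].
      apply Rinv_0_lt_compat, exp_pos.
Qed.

(** The infinite product is nonzero because the reciprocals of the partial products stay bounded. *)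
Lemma qpoch_gconv :
  exists P : C, P <> 0 /\ gconv (qpoch a Q) P /\ gconv (fun n => / qpoch a Q n) (/ P).
Proof.
  destruct (gconv_exists (exp (/ (1 - r))) (qpoch a Q)) as [P hP].
  - intros n; simpl.
    replace (qpoch a Q n * (1 - a * Q ^ n) - qpoch a Q n)
      with (- (qpoch a Q n * (a * Q ^ n))) by ring.
    rewrite Cmod_opp, Cmod_mult.
    apply Rmult_le_compat; auto using Cmod_ge_0.
    + apply Rle_trans with (1 := qpoch_upper n), exp_le.
      pose proof (rpow_bounds n).
      assert (0 < / (1 - r))%R by (apply Rinv_0_lt_compat; lra).
      unfold Rdiv; nra.
    + apply Rle_trans with (1 := Cmod_factor n), rpow_anti; lia.
  - exists P.
    destruct (gconv_inv (qpoch a Q) P (exp (/ (1 - r) / (1 - r)))) as [h1 h2]; auto.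
    + apply qpoch_factors_neq_0.
    + intros n; apply Rle_trans with (1 := qpoch_inv_upper n), exp_le.
      apply Rmult_le_compat_r; [left; apply Rinv_0_lt_compat; lra|].
      pose proof (rpow_bounds n).
      assert (0 < / (1 - r))%R by (apply Rinv_0_lt_compat; lra).
      unfold Rdiv; nra.
Qed.

End Product.
End Geometric.

(** * Bounds for theta coefficients, and dissection modulo 5 *)

(** The quadratic power of [Q] is bounded by [1]; a geometric bound suffices for the convolution
    lemma, with [b = r ^ 2]. *)
Lemma Cmod_theta (b : R) (Q x : C) (j : nat) :
  (Cmod Q <= 1)%R -> (Cmod x <= b)%R -> (Cmod (theta Q x j) <= b ^ j)%R.
Proof.
  intros hQ hx; induction j as [|j IH]; simpl.
  - rewrite Cmod_1; lra.
  - rewrite !Cmod_mult, Cmod_opp, Cmod_pow.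
    assert (h : (Cmod Q ^ j <= 1)%R).
    { rewrite <- (pow1 j); apply pow_incr; split; [apply Cmod_ge_0|assumption]. }
    replace (b * b ^ j)%R with (b ^ j * b * 1)%R by ring.
    repeat (apply Rmult_le_compat; auto using Cmod_ge_0).
    + apply Rmult_le_pos; apply Cmod_ge_0.
    + apply pow_le, Cmod_ge_0.
Qed.

Lemma Cmod_foldt (b : R) (Q x y : C) (e j : nat) : (b <= 1)%R ->
  (Cmod Q <= 1)%R -> (Cmod x <= b)%R -> (Cmod y <= b)%R ->
  (Cmod (fold_theta e Q x y j) <= 2 * b ^ j)%R.
Proof.
  intros hb hQ hx hy.
  assert (b0 : (0 <= b)%R) by (apply Rle_trans with (2 := hx), Cmod_ge_0).
  pose proof (pow_le b j b0).
  pose proof (Cmod_theta b Q x j hQ hx) as Hx.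
  destruct e as [|e]; unfold fold_theta, fold0, fold1.
  - destruct j as [|j]; [rewrite Cmod_1; simpl; lra|].
    pose proof (Cmod_theta b Q y (S j) hQ hy).
    apply Rle_trans with (1 := Cmod_triangle _ _); lra.
  - pose proof (Cmod_theta b Q y (S j) hQ hy) as Hy; simpl pow in Hy.
    apply Rle_trans with (1 := Cmod_triangle _ _); nra.
Qed.

(** Sorts the factors [1 - q^k] by the residue of [k] modulo 5. *)
Lemma qpoch_dissect5 (q : C) (n : nat) :
  qpoch q q (5 * n) = qpoch q (q ^ 5) n * qpoch (q ^ 2) (q ^ 5) n * qpoch (q ^ 3) (q ^ 5) n
                      * qpoch (q ^ 4) (q ^ 5) n * qpoch (q ^ 5) (q ^ 5) n.
Proof.
  induction n as [|n IH].
  - simpl; ring.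
  - replace (5 * S n)%nat with (S (S (S (S (S (5 * n)))))) by lia.
    cbn [qpoch]; rewrite IH, <- Cpow_mult_r, !Cpow_S; ring.
Qed.

(** * The Rogers-Ramanujan sums *)

Section Limits.

Variable q : C.
Hypothesis hq : (Cmod q < 1)%R.

(** The square root turns decay like [|q|^n] into [r^(2n)], the double rate that [gconv_convolution]
    asks for. *)
Let r := sqrt (Cmod q).

Lemma r_nonneg : (0 <= r)%R.
Proof. apply sqrt_pos. Qed.

Lemma r_sqr : (r ^ 2 = Cmod q)%R.
Proof. simpl; rewrite Rmult_1_r; apply sqrt_sqrt, Cmod_ge_0. Qed.

Lemma r_lt_1 : (r < 1)%R.
Proof.
  unfold r; rewrite <- sqrt_1; apply sqrt_lt_1; [apply Cmod_ge_0|lra|assumption].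
Qed.

Lemma Cmod_Cpow_le (m n : nat) : (n <= m)%nat -> (Cmod (q ^ m) <= r ^ (2 * n))%R.
Proof.
  intros H; rewrite Cmod_pow, <- r_sqr, <- pow_mult.
  apply rpow_anti; auto using r_nonneg, r_lt_1; lia.
Qed.

Lemma Cmod_Cpow_le_r (m : nat) : (1 <= m)%nat -> (Cmod (q ^ m) <= r)%R.
Proof.
  intros H; apply Rle_trans with (1 := Cmod_Cpow_le m 1 H).
  rewrite <- (pow_1 r) at 2; apply rpow_anti; auto using r_nonneg, r_lt_1 with arith.
Qed.

Lemma Cmod_q_le_r : (Cmod q <= r)%R.
Proof. rewrite <- (Cpow_1_r q); apply Cmod_Cpow_le_r; lia. Qed.

Lemma regular_Cpow (m : nat) : (1 <= m)%nat -> regular (q ^ m).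
Proof.
  intros H; apply regular_of_Cmod.
  apply Rle_lt_trans with (1 := Cmod_Cpow_le_r m H), r_lt_1.
Qed.

Lemma regular_q : regular q.
Proof. apply regular_of_Cmod, hq. Qed.

Lemma iq_bounded (m : nat) : (1 <= m)%nat ->
  exists M, forall n, (Cmod (iq (q ^ m) n) <= M)%R.
Proof.
  intros H.
  destruct (qpoch_gconv r r_nonneg r_lt_1 (q ^ m) (q ^ m)
              (Cmod_Cpow_le_r m H) (Cmod_Cpow_le_r m H)) as [P [_ [_ hP]]].
  exact (gconv_bounded r r_nonneg r_lt_1 _ _ hP).
Qed.

(** Let [T] be the sum of the theta coefficients. The finite Rogers-Ramanujan identity tends to
    [L / P = T / P^2], the finite triple product in base [q ^ 5] to [T / P5^2 = Px Py / P5];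
    eliminating [T] gives the claim. *)
Lemma theta_quotient (e : nat) (x y P P5 Px Py : C) : (e <= 1)%nat ->
  q ^ 5 = x * y -> (Cmod x <= r ^ 2)%R -> (Cmod y <= r ^ 2)%R ->
  (forall j, fold_theta e (q ^ 5) x y j = fold_theta e q 1 q j * q ^ (2 * (j * j + e * j))) ->
  P <> 0 -> gconv r (iq q) (/ P) ->
  P5 <> 0 -> gconv r (iq (q ^ 5)) (/ P5) ->
  gconv r (qpoch x (q ^ 5)) Px -> gconv r (qpoch y (q ^ 5)) Py ->
  exists L, gconv r (fun N => csum N (fun n => q ^ (n * n + e * n) * iq q n)) L
            /\ L * P = Px * Py * P5.
Proof.
  intros he hxy hx hy hfold hP giq hP5 giq5 gx gy.
  pose proof r_nonneg as r0; pose proof r_lt_1 as r1.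
  assert (anti : forall m n, (m <= n)%nat -> (r ^ n <= r ^ m)%R) by (apply rpow_anti; assumption).
  destruct (gconv_bounded r r0 r1 _ _ giq) as [M hM].
  assert (hM0 : (0 <= M)%R) by (apply Rle_trans with (2 := hM O), Cmod_ge_0).
  set (g := fun n => q ^ (n * n + e * n) * iq q n).
  assert (hg : forall n, (Cmod (g n) <= M * r ^ (2 * n))%R).
  { intros n; unfold g; rewrite Cmod_mult, Rmult_comm.
    apply Rmult_le_compat; auto using Cmod_ge_0.
    apply Cmod_Cpow_le; nia. }
  set (al := fold_theta e (q ^ 5) x y).
  assert (hal : forall n, (Cmod (al n) <= 2 * r ^ (2 * n))%R).
  { intros n; rewrite pow_mult; apply Cmod_foldt; try assumption.
    - apply (anti 0%nat 2%nat); lia.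
    - apply Rle_trans with r; [apply Cmod_Cpow_le_r; lia|lra]. }
  destruct (gconv_csum r r0 r1 M g) as [L hL].
  { intros n; apply Rle_trans with (1 := hg n), Rmult_le_compat_l; [assumption|apply anti; lia]. }
  destruct (gconv_csum r r0 r1 2 al) as [T hT].
  { intros n; apply Rle_trans with (1 := hal n), Rmult_le_compat_l; [lra|apply anti; lia]. }
  exists L; split; [exact hL|].
  assert (shift : forall u l, gconv r u l -> gconv r (fun n => u (n + e)%nat) l).
  { intros u l; apply (gconv_comp r r0 r1 u l (fun n => (n + e)%nat)); intros; lia. }
  (* The constant sequence [1] fills the third slot of the convolution on the left. *)
  assert (E1 : L * (/ P * 1) = T * (/ P * / P)).
  { apply (gconv_unique r r0 r1
      (fun N => csum (S N) (fun s => g s * iq q (N - s) * 1))).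
    - apply (gconv_convolution r r0 r1 M g (iq q) (fun _ => 1)); auto.
      apply gconv_const.
    - apply (gconv_ext r (fun N => csum (S N) (fun s => al s * iq q (N - s) * iq q (N + s + e)))).
      + intros N; transitivity (csum (S N) (fun s => g s * iq q (N - s))).
        * unfold g; rewrite finite_rogers_ramanujan by auto using regular_q.
          apply csum_ext; intros j _; unfold al; rewrite hfold.
          replace (N + e + j)%nat with (N + j + e)%nat by lia; reflexivity.
        * apply csum_ext; intros; ring.
      + apply (gconv_convolution r r0 r1 2 al (iq q) (fun n => iq q (n + e))); auto. }
  (* The same coefficients [al], hence the same [T], now convolved with reciprocals in base
     [q ^ 5]. *)
  assert (E2 : T * (/ P5 * / P5) = Px * Py * / P5).
  { apply (gconv_unique r r0 r1
      (fun N => csum (S N) (fun s => al s * iq (q ^ 5) (N - s) * iq (q ^ 5) (N + s + e)))).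
    - apply (gconv_convolution r r0 r1 2 al (iq (q ^ 5)) (fun n => iq (q ^ 5) (n + e))); auto.
    - apply (gconv_ext r (fun n => qpoch x (q ^ 5) n * qpoch y (q ^ 5) (n + e)
                                   * iq (q ^ 5) (2 * n + e))).
      + intros n; rewrite <- finite_triple by (auto; apply regular_Cpow; lia).
        apply csum_ext; intros j _.
        replace (n + e + j)%nat with (n + j + e)%nat by lia; reflexivity.
      + apply (gconv_mult r r0 r1); [apply (gconv_mult r r0 r1)|]; auto.
        apply (gconv_comp r r0 r1 _ _ (fun n => (2 * n + e)%nat)); auto; intros; lia. }
  assert (E1' : L * P = T).
  { transitivity (L * (/ P * 1) * (P * P)); [field; assumption|].
    rewrite E1; field; assumption. }
  rewrite E1'.
  transitivity (T * (/ P5 * / P5) * (P5 * P5)); [field; assumption|].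
  rewrite E2; field; assumption.
Qed.

(** The square partial sum is the weighted triangle [i + 2j < N], which [double_to_single]
    evaluates, plus a tail of order [r^N]. *)
Lemma dsum_of_single (e : nat) (L : C) :
  gconv r (fun N => csum N (fun n => q ^ (n * n + e * n) * iq q n)) L ->
  dsum_is (fun i j => q ^ ((i + 2 * j) * (i + 2 * j) + e * (i + 2 * j)) * euler_coef q i
                      * iq (q ^ 2) j) L.
Proof.
  intros hL.
  pose proof r_nonneg as r0; pose proof r_lt_1 as r1.
  destruct (iq_bounded 1 ltac:(lia)) as [M1 hM1]; rewrite Cpow_1_r in hM1.
  destruct (iq_bounded 2 ltac:(lia)) as [M2 hM2].
  assert (p1 : (0 <= M1)%R) by (apply Rle_trans with (2 := hM1 O), Cmod_ge_0).
  assert (p2 : (0 <= M2)%R) by (apply Rle_trans with (2 := hM2 O), Cmod_ge_0).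
  set (f := fun i j => q ^ ((i + 2 * j) * (i + 2 * j) + e * (i + 2 * j)) * euler_coef q i
                      * iq (q ^ 2) j).
  assert (hf : forall i j, (Cmod (f i j) <= M1 * M2 * r ^ (2 * (i + 2 * j)))%R).
  { intros i j; unfold f, euler_coef; rewrite !Cmod_mult.
    assert (B1 : (Cmod (q ^ ((i + 2 * j) * (i + 2 * j) + e * (i + 2 * j)))
                  <= r ^ (2 * (i + 2 * j)))%R) by (apply Cmod_Cpow_le; nia).
    assert (B2 : (Cmod (q ^ tri i) <= 1)%R) by (apply (Cmod_Cpow_le (tri i) 0); lia).
    replace (M1 * M2 * r ^ (2 * (i + 2 * j)))%R
      with (r ^ (2 * (i + 2 * j)) * (1 * M1) * M2)%R by ring.
    repeat (apply Rmult_le_compat; auto using Cmod_ge_0, Rmult_le_pos). }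
  apply (gconv_filterlim r r0 r1).
  destruct hL as [K hK].
  exists (M1 * M2 / (1 - r) / (1 - r) + K)%R; intros N.
  set (tail := csum N (fun j => csum N (fun i =>
                 if (N - 2 * j <=? i)%nat then f i j else 0))).
  replace (csum N (fun i => csum N (fun j => f i j)))
    with (tail + csum N (fun n => q ^ (n * n + e * n) * iq q n)).
  2: { rewrite <- double_to_single by (apply regular_q || (apply regular_Cpow; lia)).
       rewrite csum_swap; unfold tail; rewrite <- csum_plus.
       apply csum_ext; intros j _.
       rewrite (csum_tail (N - 2 * j) N (fun i => f i j)) by lia; unfold f; ring. }
  match goal with |- (Cmod (tail + ?s - L) <= _)%R =>
    replace (tail + s - L) with (tail + (s - L)) by ring end.
  apply Rle_trans with (1 := Cmod_triangle _ _).
  rewrite Rmult_plus_distr_r; apply Rplus_le_compat; [|apply hK].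
  replace (M1 * M2 / (1 - r) / (1 - r) * r ^ N)%R
    with (M1 * M2 * r ^ N / (1 - r) / (1 - r))%R by (field; lra).
  assert (pN : (0 <= r ^ N)%R) by (apply pow_le; assumption).
  assert (pr : (0 <= / (1 - r))%R) by (left; apply Rinv_0_lt_compat; lra).
  apply Cmod_csum_le; [assumption..| |].
  { unfold Rdiv; auto using Rmult_le_pos. }
  intros j _.
  replace (M1 * M2 * r ^ N / (1 - r) * r ^ j)%R
    with (M1 * M2 * r ^ N * r ^ j / (1 - r))%R by (field; lra).
  assert (pj : (0 <= r ^ j)%R) by (apply pow_le; assumption).
  apply Cmod_csum_le; [assumption..| |].
  { auto using Rmult_le_pos. }
  intros i _; destruct (Nat.leb_spec (N - 2 * j) i) as [H|H].
  (* Here [i + 2j >= N], hence [2(i + 2j) >= N + j + i]: one factor [r^N], and geometric decay in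
     both indices. *)
  - apply Rle_trans with (1 := hf i j).
    rewrite !(Rmult_assoc (M1 * M2)), <- !pow_add.
    apply Rmult_le_compat_l; [auto using Rmult_le_pos|].
    apply rpow_anti; auto; lia.
  - rewrite Cmod_0; repeat apply Rmult_le_pos; auto using pow_le.
Qed.

(** The exponent [m] is left free so that both forms in the theorem, with their division by 2, can
    be matched by a side equation. *)
Lemma summand_eq (e i j m : nat) : (m = i * i + e * i + tri i + 4 * i * j + 4 * j * j + 2 * e * j)%nat ->
  q ^ ((i + 2 * j) * (i + 2 * j) + e * (i + 2 * j)) * euler_coef q i * iq (q ^ 2) j
  = q ^ m / (qpoch q q i * qpoch (q ^ 2) (q ^ 2) j).
Proof.
  intros ->.
  replace (i * i + e * i + tri i + 4 * i * j + 4 * j * j + 2 * e * j)%nat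
    with ((i + 2 * j) * (i + 2 * j) + e * (i + 2 * j) + tri i)%nat by ring.
  rewrite (Cpow_add_r q _ (tri i)); unfold euler_coef, iq; field.
  split; apply qpoch_neq_0; [apply regular_Cpow; lia|apply regular_q].
Qed.

Lemma dsum_is_ext (f g : nat -> nat -> C) (S : C) :
  (forall i j, f i j = g i j) -> dsum_is f S -> dsum_is g S.
Proof.
  intros H; apply filterlim_ext; intros N.
  apply csum_ext; intros i _; apply csum_ext; intros j _; apply H.
Qed.

End Limits.

(** * Exponents of the theorem, and the final assembly *)

Lemma exponent0 (i : nat) : (i * (3 * i - 1) / 2 = i * i + tri i)%nat.
Proof.
  symmetry; apply Nat.div_unique_exact; [lia|].
  (* At [i = 0] the truncated [3 * i - 1] is [0], harmless because of the factor [i]. *)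
  pose proof (tri_double i); destruct i; nia.
Qed.

Lemma exponent1 (i : nat) : (i * (3 * i + 1) / 2 = i * i + i + tri i)%nat.
Proof.
  symmetry; apply Nat.div_unique_exact; [lia|]; pose proof (tri_double i); nia.
Qed.

Theorem theorem3p4 (q : C) (hq : (Cmod q < 1)%R) :
  (exists P1 P4 : C,
     qpoch_inf_is q (Cpow q 5) P1 /\ qpoch_inf_is (Cpow q 4) (Cpow q 5) P4 /\
     dsum_is (fun i j =>
       Cpow q ((i * (3 * i - 1)) / 2 + 4 * i * j + 4 * j * j)%nat
       / (qpoch q q i * qpoch (Cpow q 2) (Cpow q 2) j))
       (/ (P1 * P4))) /\
  (exists P2 P3 : C,
     qpoch_inf_is (Cpow q 2) (Cpow q 5) P2 /\ qpoch_inf_is (Cpow q 3) (Cpow q 5) P3 /\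
     dsum_is (fun i j =>
       Cpow q ((i * (3 * i + 1)) / 2 + 4 * i * j + 4 * j * j + 2 * j)%nat
       / (qpoch q q i * qpoch (Cpow q 2) (Cpow q 2) j))
       (/ (P2 * P3))).
Proof.
  set (r := sqrt (Cmod q)).
  assert (r0 : (0 <= r)%R) by apply r_nonneg.
  assert (r1 : (r < 1)%R) by (apply r_lt_1; assumption).
  assert (hr : forall m, (1 <= m)%nat -> (Cmod (q ^ m) <= r)%R)
    by (intros; apply Cmod_Cpow_le_r; assumption).
  assert (hr2 : forall m, (1 <= m)%nat -> (Cmod (q ^ m) <= r ^ 2)%R)
    by (intros m Hm; apply (Cmod_Cpow_le q hq m 1 Hm)).
  assert (hqr : (Cmod q <= r)%R) by (apply Cmod_q_le_r; assumption).
  assert (hqr2 : (Cmod q <= r ^ 2)%R) by (apply Req_le; symmetry; apply r_sqr).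
  assert (prod5 : forall a, (Cmod a <= r)%R -> exists P : C, P <> 0 /\
     gconv r (qpoch a (q ^ 5)) P /\ gconv r (fun n => / qpoch a (q ^ 5) n) (/ P)).
  { intros a ha; apply qpoch_gconv; auto; apply hr; lia. }
  destruct (qpoch_gconv r r0 r1 q q hqr hqr) as [P [nP [gP iP]]].
  destruct (prod5 q hqr) as [P1 [n1 [g1 _]]].
  destruct (prod5 (q ^ 2) (hr 2%nat ltac:(lia))) as [P2 [n2 [g2 _]]].
  destruct (prod5 (q ^ 3) (hr 3%nat ltac:(lia))) as [P3 [n3 [g3 _]]].
  destruct (prod5 (q ^ 4) (hr 4%nat ltac:(lia))) as [P4 [n4 [g4 _]]].
  destruct (prod5 (q ^ 5) (hr 5%nat ltac:(lia))) as [P5 [n5 [g5 i5]]].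
  (* The subsequence of index [5 * n] of the partial products of [(q;q)_oo] has the limit [P] and,
     dissected, the product of the five limits. *)
  assert (EP : P = P1 * P2 * P3 * P4 * P5).
  { apply (gconv_unique r r0 r1 (fun n => qpoch q q (5 * n))).
    - apply (gconv_comp r r0 r1 (qpoch q q) P (fun n => (5 * n)%nat)); [intros; lia|assumption].
    - apply (gconv_ext r _ _ _ (fun n => eq_sym (qpoch_dissect5 q n))).
      repeat apply (gconv_mult r r0 r1); assumption. }
  split.
  (* The pair [(q^2, q^3)] gives [L = P2 P3 P5 / P], which leaves [1 / (P1 P4)]. *)
  - destruct (theta_quotient q hq 0 (q ^ 2) (q ^ 3) P P5 P2 P3) as [L [hL EL]]; auto;
      [ring|intros j; rewrite fold_theta_q5_0; do 3 f_equal; lia|].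
    exists P1, P4; split; [|split].
    + apply (gconv_filterlim r r0 r1), g1.
    + apply (gconv_filterlim r r0 r1), g4.
    + replace (/ (P1 * P4)) with L.
      * apply dsum_is_ext with (2 := dsum_of_single q hq 0 L hL).
        intros i j; apply (summand_eq q hq); rewrite exponent0; lia.
      * transitivity (L * P / P); [field; assumption|].
        rewrite EL, EP; field; auto.
  (* The pair [(q^4, q)], in this order because [fold1] shifts the index of its second theta term,
     gives [L = P4 P1 P5 / P = 1 / (P2 P3)]. *)
  - destruct (theta_quotient q hq 1 (q ^ 4) q P P5 P4 P1) as [L [hL EL]]; auto;
      [ring|intros j; rewrite fold_theta_q5_1; do 3 f_equal; lia|].
    exists P2, P3; split; [|split].
    + apply (gconv_filterlim r r0 r1), g2.
    + apply (gconv_filterlim r r0 r1), g3.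
    + replace (/ (P2 * P3)) with L.
      * apply dsum_is_ext with (2 := dsum_of_single q hq 1 L hL).
        intros i j; apply (summand_eq q hq); rewrite exponent1; lia.
      * transitivity (L * P / P); [field; assumption|].
        rewrite EL, EP; field; auto.
Qed.
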